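(* Let $\mathcal{A}$ be an $\mathbb{R}$-embeddable almost disjoint family of subsets of $\mathbb{N}$. Whenever $\varepsilon>0$ and $\mathcal{Y}$ is a subset of the unit sphere of $(\mathcal{X}_{\mathcal{A}},\|\cdot\|_\infty)$ of regular uncountable cardinality $\kappa$, there is $\mathcal{Y}'\subseteq\mathcal{Y}$ of cardinality $\kappa$ which is $(1+\varepsilon)$-concentrated.
   Context: A family $\mathcal{A}$ of subsets of $\mathbb{N}$ is almost disjoint if $A\cap A'$ is finite for any distinct $A,A'\in\mathcal{A}$; all almost disjoint families considered are uncountable and consist of infinite sets. An almost disjoint family $\mathcal{A}$ is $\mathbb{R}$-embeddable if there is a function $\phi:\mathbb{N}\to\mathbb{R}$ such that for each $A\in\mathcal{A}$ the limit $\lim_{n\in A}\phi(n)$ (along any enumeration of $A$) exists in $\mathbb{R}$, and these limits are distinct for distinct $A\in\mathcal{A}$. The space $\mathcal{X}_{\mathcal{A}}$ is the closed linear span in the real Banach space $(\ell_\infty(\mathbb{N}),\|\cdot\|_\infty)$ of $\{1_A:A\in\mathcal{A}\}\cup c_0$, where $1_A$ is the characteristic function of $A$. For $r>0$, a subset $\mathcal{Y}$ of a Banach space is $r$-concentrated if $\|y-y'\|\le r$ for any two distinct $y,y'\in\mathcal{Y}$. *)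

(* Defs.v *)
From HB Require Import structures.
From mathcomp Require Import all_boot all_order all_algebra.
From mathcomp Require Import all_classical all_reals all_analysis.

Set Implicit Arguments.
Unset Strict Implicit.
Unset Printing Implicit Defensive.

Import Order.TTheory GRing.Theory Num.Theory.
Import numFieldNormedType.Exports.

Local Open Scope classical_set_scope.
Local Open Scope card_scope.
Local Open Scope ring_scope.

Section EllInfty.
Variable R : realType.

Definition bounded_seq : {pred nat -> R^o} := fun x => `[< bounded_fun x >].

Record ell_infty :=
  EllInfty { ell_infty_val :> nat -> R^o; _ : ell_infty_val \in bounded_seq }.

HB.instance Definition _ := [isSub for ell_infty_val].
HB.instance Definition _ := [Choice of ell_infty by <:].

Lemma bounded_seqP (x : nat -> R^o) :
  x \in bounded_seq <-> exists M, forall n, `|x n| <= M.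
Proof.
rewrite unfold_in /bounded_seq asboolE; split.
  by move=> [M [_ /(_ (M + 1))]]; rewrite ltrDl ltr01 => /(_ isT) h; exists (M + 1) => n; exact: h.
by move=> [M hM]; exists M; split=> [|N MN n _]; [exact: num_real|exact: le_trans (hM n) (ltW MN)].
Qed.

Lemma bounded_seq_submod_closed : submod_closed bounded_seq.
Proof.
split; first by apply/bounded_seqP; exists 0 => n; rewrite normr0.
move=> a x y /bounded_seqP[M hM] /bounded_seqP[N hN].
apply/bounded_seqP; exists (`|a| * M + N) => n.
rewrite (le_trans (ler_normD _ _))// lerD ?hN//.
by rewrite normrM ler_wpM2l.
Qed.

HB.instance Definition _ :=
  GRing.isSubmodClosed.Build _ _ bounded_seq bounded_seq_submod_closed.
HB.instance Definition _ := [SubChoice_isSubLmodule of ell_infty by <:].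

Definition sup_norm (x : ell_infty) : R := sup (range (fun n => `|x n|)).

Lemma sup_norm_ub (x : ell_infty) n : `|x n| <= sup_norm x.
Proof.
apply: ub_le_sup; last by exists n.
have /bounded_seqP[M hM] := valP x.
by exists M => _ [k _ <-]; exact: hM.
Qed.

Lemma sup_norm_le (x : ell_infty) M :
  (forall n, `|x n| <= M) -> sup_norm x <= M.
Proof.
move=> hM; apply: ge_sup; first by exists `|x 0%N|, 0%N.
by move=> _ [n _ <-]; exact: hM.
Qed.

Lemma sup_normD x y : sup_norm (x + y) <= sup_norm x + sup_norm y.
Proof.
apply: sup_norm_le => n; rewrite (le_trans (ler_normD _ _))//.
by rewrite lerD ?sup_norm_ub.
Qed.

Lemma sup_normZ a x : sup_norm (a *: x) = `|a| * sup_norm x.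
Proof.
have leZ b z : sup_norm (b *: z) <= `|b| * sup_norm z.
  by apply: sup_norm_le => n; rewrite normrM ler_wpM2l ?sup_norm_ub.
apply/le_anti/andP; split; first exact: leZ.
have [->|a0] := eqVneq a 0.
  by rewrite normr0 mul0r (le_trans _ (sup_norm_ub _ 0%N)).
rewrite mulrC -ler_pdivlMr ?normr_gt0// mulrC -normfV.
by rewrite -{1}(scale1r x) -(mulVf a0) -scalerA leZ.
Qed.

Lemma sup_norm_eq0 x : sup_norm x = 0 -> x = 0.
Proof.
move=> x0; apply/val_inj/funext => n; apply/eqP.
by rewrite -normr_le0 -x0 sup_norm_ub.
Qed.

HB.instance Definition _ :=
  Lmodule_isNormed.Build R ell_infty sup_normD sup_normZ sup_norm_eq0.

Definition c0 : set ell_infty := [set x | x n @[n --> \oo] --> (0 : R^o)].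

End EllInfty.
Arguments c0 : clear implicits.

Definition linear_span (R : realType) (V : lmodType R) (G : set V) : set V :=
  [set x | exists n (a : 'I_n -> R) (v : 'I_n -> V),
    (forall i, G (v i)) /\ x = \sum_(i < n) a i *: v i].

Definition almost_disjoint_family (F : set (set nat)) : Prop :=
  [/\ ~ countable F,
      forall A, F A -> infinite_set A &
      forall A B, F A -> F B -> A <> B -> finite_set (A `&` B)].

(* For infinite A, the filter [within A \oo] consists of the sets containing
   all but finitely many elements of A, so its limits are the limits along
   any enumeration of A. *)
Definition R_embeddable (R : realType) (F : set (set nat)) : Prop :=
  exists phi : nat -> R,
    (forall A, F A -> cvg (phi @ within A \oo)) /\
    (forall A B, F A -> F B -> A <> B ->
      lim (phi @ within A \oo) <> lim (phi @ within B \oo)).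

Definition char_functions (R : realType) (F : set (set nat)) :
    set (ell_infty R) :=
  [set x | exists2 A, F A & x = \1_A :> (nat -> R)].

Definition X_space (R : realType) (F : set (set nat)) : set (ell_infty R) :=
  closure (linear_span (char_functions F `|` c0 R)).

Definition concentrated (R : realType) (V : normedModType R) (r : R)
    (Y : set V) : Prop :=
  forall y y', Y y -> Y y' -> y <> y' -> `|y - y'| <= r.

Definition card_lt (T U : Type) (A : set T) (B : set U) : Prop :=
  (A #<= B) /\ (A #!= B).

(* A cardinal is represented by a set K of that cardinality. It is regular
   when K is infinite and is not a union of fewer than |K| sets of cardinality
   less than |K|; an index set smaller than K can be taken inside the carrier
   type of K. *)
Definition regular_cardinal (T : Type) (K : set T) : Prop :=
  infinite_set K /\
  forall (I : set T) (S : T -> set T),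
    card_lt I K -> (forall i, I i -> card_lt (S i) K) ->
    \bigcup_(i in I) S i <> K.

(* Main.v *)
From HB Require Import structures.
Require Import Defs.
From mathcomp Require Import all_boot all_order all_algebra.
From mathcomp Require Import all_classical all_reals all_analysis.
From mathcomp Require Import lra.

Set Implicit Arguments.
Unset Strict Implicit.
Unset Printing Implicit Defensive.

Import Order.TTheory GRing.Theory Num.Theory.
Import numFieldNormedType.Exports.

Local Open Scope classical_set_scope.
Local Open Scope card_scope.
Local Open Scope ring_scope.

(** Let [phi] witness that [F] is R-embeddable. An element [y] of the span
    converges along every member of [F], and tends to 0 off the union of
    finitely many members. Since the limits of [phi] along these members are
    distinct, a rational step function of [phi] separates them, so up to an
    arbitrarily small error every [y k] is either 0 or [s k], where [s] ranges
    over a countable set of functions; this passes to the closure. Two unit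
    vectors with the same [s] are, up to the error, at each coordinate either
    equal or one of them vanishes, so their distance is at most 1 plus the
    error. By regularity of the uncountable cardinal, one [s] is shared by
    kappa many vectors. *)

Lemma filter_all_seq (T : Type) (U : eqType) (F : set_system T) {FF : Filter F}
    (l : seq U) (P : U -> T -> Prop) :
  (forall u, u \in l -> F (P u)) -> F (fun t => forall u, u \in l -> P u t).
Proof.
elim: l => [|u l IH] lP; first by apply: filterE.
have uP := lP u (mem_head _ _).
have {}IH := IH (fun w wl => lP w (@mem_behead _ (u :: l) _ wl)).
apply: filterS (filterI uP IH) => t [Put Pl] w.
by rewrite inE => /predU1P[->//|/Pl].
Qed.

Lemma ratr_approx (R : realType) (x d : R) : 0 < d ->
  exists q : rat, `|ratr q - x| <= d.
Proof.
move=> d0; have [|q] := @rat_in_itvoo R (x - d) (x + d); first by lra.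
by rewrite in_itv/= => /andP[? ?]; exists q; rewrite ler_norml; lra.
Qed.

(** All data are rational so that only countably many such functions exist. Where intervals overlap,
    the earliest in the list wins. *)
Fixpoint step_fun (R : realType) (c : seq (rat * rat * rat)) (t : R) : R :=
  if c is (p, q, w) :: c' then
    if ratr p < t < ratr q then ratr w else step_fun c' t
  else 0.

(** Induction on [xs]: an interval around the new point [x], short enough to avoid the other points,
    is put in front, so near those points the earlier function is unchanged. *)
Lemma step_fun_approx (R : realType) (xs : seq R) (v : R -> R) (d : R) :
  0 < d -> uniq xs ->
  exists c, forall x, x \in xs -> \forall t \near x, `|step_fun c t - v x| <= d.
Proof.
move=> d0; elim: xs => [_|x xs IH /andP[xxs /IH[c cP]]]; first by exists [::].
have : \forall t \near x, forall u, u \in xs -> t != u.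
  apply: (filter_all_seq) => u uxs.
  have : u != x by apply: contraNneq xxs => <-.
  rewrite neq_lt => /orP[ux|xu].
    by apply: filterS (lt_nbhsr ux) => t; rewrite neq_lt orbC => ->.
  by apply: filterS (lt_nbhsl xu) => t; rewrite neq_lt => ->.
move=> /nbhs_ballP[e/= e0 eP].
have [|p] := @rat_in_itvoo R (x - e) x; first by lra.
rewrite in_itv/= => /andP[xep px].
have [|q] := @rat_in_itvoo R x (x + e); first by lra.
rewrite in_itv/= => /andP[xq qxe].
have [w wP] := ratr_approx (v x) d0.
exists ((p, q, w) :: c) => y; rewrite inE => /predU1P[->|yxs] /=.
  by apply: filterS (filterI (lt_nbhsr px) (lt_nbhsl xq)) => t [-> ->].
(* Near a point [y] outside [[p], [q]] the new test fails. A point inside would be at distance less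
   than [e] from [x], against the choice of [e]. *)
have [yp|py] := ltP y (ratr p).
  apply: filterS (filterI (cP _ yxs) (lt_nbhsl yp)) => t [tP tp].
  by rewrite ltNge (ltW tp).
have [qy|yq] := ltP (ratr q) y.
  apply: filterS (filterI (cP _ yxs) (lt_nbhsr qy)) => t [tP qt].
  by rewrite (ltNge t) (ltW qt) andbF.
have : ball x e y by rewrite /ball/= ltr_norml; lra.
by move=> /eP/(_ _ yxs); rewrite eqxx.
Qed.

(** If every fibre were smaller than [kappa], their images under a bijection [g] would write [kappa]
    as a countable union of smaller sets, against regularity. Since regularity indexes unions by
    subsets of [T], the fibres are relabelled through an injection [j] of the naturals into
    [kappa]. *)
Lemma regular_pigeonhole (T E : Type) (kappa : set T) (Y : set E)
    (f : E -> nat) :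
  regular_cardinal kappa -> ~ countable kappa -> Y #= kappa ->
  exists n, Y `&` [set y | f y = n] #= kappa.
Proof.
move=> [kinf kreg] kunc Yk; apply: contrapT => /forallNP fibre.
have [t0 _] := infinite_setN0 kinf.
pose T' : pointedType :=
  HB.pack T (gen_eqMixin T) (gen_choiceMixin T) (isPointed.Build T t0).
have [g [gk ginj gsurj]] := @card_set_bijP E T' Y kappa Yk.
have [j] := @pcard_leP _ T' _ _ (iffLR (infiniteP kappa) kinf).
have card_sub_lt (A : set E) : A `<=` Y -> ~ (A #= kappa) ->
    card_lt (g @` A : set T) kappa.
  move=> AY Ak.
  have gA : g @` A #= A.
    apply: inj_card_eq => x y /set_mem xA /set_mem yA; apply: ginj; exact/mem_set/AY.
  split; last by apply/negP; rewrite (card_eql gA).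
  by apply: subset_card_le => _ [x /AY xY <-]; exact: gk.
pose S (t : T) : set T := g @` (Y `&` [set y | j (f y) = t]).
apply: (kreg (range j) S).
- have jcount : countable (range j : set T).
    by apply: sub_countable (card_image_le _ _) _.
  split; first by apply: subset_card_le => _ [n _ <-]; exact: funS.
  by apply/negP => /eq_countable jk; apply: kunc; rewrite -jk.
- move=> _ [n _ <-]; rewrite /S.
  have -> : Y `&` [set y | j (f y) = j n] = Y `&` [set y | f y = n].
    apply/seteqP; split=> y [Yy /= fy]; split=> //=; last by rewrite fy.
    by apply: (@inj _ _ _ j) fy; rewrite inE.
  by apply: card_sub_lt (fibre n) => y [].
- apply/seteqP; split=> [t [_ _ [y [Yy _] <-]]|t /gsurj[y Yy <-]]; first exact: gk.
  by exists (j (f y)) => //; exists y.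
Qed.

(** The list [c.1] patches an initial segment, about which limits say nothing. *)
Definition code_fun (R : realType) (phi : nat -> R)
    (c : seq rat * seq (rat * rat * rat)) (k : nat) : R :=
  if (k < size c.1)%N then ratr (nth 0 c.1 k) else step_fun c.2 (phi k).

Section Span.
Variables (R : realType) (F : set (set nat)).

(** A property shared by the generators and stable under linear combinations; a finite [L], rather
    than a single member, is what allows sums. *)
Definition tame (y : nat -> R^o) :=
  (forall A, F A -> cvg (y @ within A \oo)) /\
  exists L, [/\ finite_set L, L `<=` F &
    y @ within (~` \bigcup_(A in L) A) \oo --> (0 : R^o)].

Lemma tameD y z : tame y -> tame z -> tame (fun k => y k + z k).
Proof.
move=> [yF [L [Lfin LF y0]]] [zF [M [Mfin MF z0]]]; split.
  by move=> A FA; apply: (@is_cvgD _ R^o); [exact: yF|exact: zF].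
exists (L `|` M); split.
- by rewrite finite_setU.
- by move=> A [/LF|/MF].
- rewrite -[0 : R^o]addr0; apply: (@cvgD _ R^o).
  + apply: cvg_trans y0; apply: cvg_app; apply: within_subset => k kLM [A LA Ak].
    by apply: kLM; exists A => //; left.
  + apply: cvg_trans z0; apply: cvg_app; apply: within_subset => k kLM [A LA Ak].
    by apply: kLM; exists A => //; right.
Qed.

Lemma tameZ a y : tame y -> tame (fun k => a *: y k).
Proof.
move=> [yF [L [Lfin LF y0]]]; split.
  by move=> A FA; apply: (@is_cvgZl_tmp _ R^o); exact: yF.
exists L; split=> //.
by rewrite -[0 : R^o](scaler0 _ a); exact: (@cvgZl_tmp _ R^o).
Qed.

Lemma tame_c0 (y : ell_infty R) : c0 R y -> tame y.
Proof.
move=> y0; split; first by move=> A _; apply: cvg_app_within; apply/cvg_ex; exists 0.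
by exists set0; split=> //; apply: cvg_within_filter.
Qed.

(** Along another member [B] the function is eventually 0 because [A] meets [B] in a finite set; off
    [A] it vanishes, so [L] is the singleton of [A]. *)
Lemma tame_indic (A : set nat) : almost_disjoint_family F -> F A ->
  tame (\1_A : nat -> R).
Proof.
move=> [_ _ Fad] FA; split=> [B FB|].
  have [->|/eqP AB] := eqVneq A B.
    apply/cvg_ex; exists (1 : R^o); apply: cvg_near_cst.
    by near do rewrite indicE mem_set//; exact: near_withinT.
  apply/cvg_ex; exists (0 : R^o); apply: cvg_near_cst.
  have /finite_seqP[s ABs] := Fad _ _ FA FB AB.
  have smax : \forall k \near \oo, forall u, u \in s -> (u < k)%N.
    by apply: filter_all_seq => u _; exact: nbhs_infty_gt.
  rewrite near_withinE; apply: filterS smax => k sk Bk.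
  rewrite indicE memNset// => Ak.
  have : (A `&` B) k by [].
  by rewrite ABs => /sk; rewrite ltnn.
exists [set A]; split=> //; first by move=> _ ->.
rewrite bigcup_set1; apply: cvg_near_cst.
by rewrite near_withinE; near=> k => Ak; rewrite indicE memNset.
Unshelve. all: by end_near. Qed.

Lemma tame_span (y : ell_infty R) : almost_disjoint_family F ->
  linear_span (char_functions F `|` c0 R) y -> tame y.
Proof.
move=> Fad [n [a [v [vG ->]]]].
elim/big_ind : _ => [|x z|i _].
- by apply: tame_c0; exact: cvg_cst.
- exact: tameD.
- apply: tameZ; have [[A FA vA]|] := vG i; last exact: tame_c0.
  by have := tame_indic Fad FA; rewrite -vA.
Qed.

End Span.

Lemma tame_code (R : realType) (F : set (set nat)) (phi : nat -> R)
    (y : nat -> R^o) (d : R) :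
  (forall A, F A -> cvg (phi @ within A \oo)) ->
  (forall A B, F A -> F B -> A <> B ->
     lim (phi @ within A \oo) <> lim (phi @ within B \oo)) ->
  tame F y -> 0 < d ->
  exists c, forall k, `|y k| <= d \/ `|y k - code_fun phi c k| <= d.
Proof.
move=> phicvg phiinj [ycvg [L [/finite_seqP[l ->] lF y0]]] d0.
have d20 : 0 < d / 2 by rewrite divr_gt0.
(* Since [phi] has distinct limits along distinct members, each real [x] is the limit along at most
   one of them, so [v] is well defined; it takes the default 0 elsewhere. *)
have [v vP] : exists v : R -> R, forall A, F A ->
    v (lim (phi @ within A \oo)) = lim (y @ within A \oo).
  suff /choice[v vP] : forall x : R, exists w : R, forall A, F A ->
      lim (phi @ within A \oo) = x -> lim (y @ within A \oo) = w.
    by exists v => A FA; rewrite (vP _ A FA erefl).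
  move=> x; have [[A [FA Ax]]|nA] :=
      pselect (exists A, F A /\ lim (phi @ within A \oo) = x).
    exists (lim (y @ within A \oo)) => B FB Bx.
    have [->//|/eqP BA] := eqVneq B A.
    by case: (phiinj _ _ FB FA BA); rewrite Ax Bx.
  by exists 0 => A FA Ax; case: nA; exists A.
pose xs := undup [seq lim (phi @ within A \oo) | A <- l].
have [c cP] := step_fun_approx v d20 (undup_uniq _ : uniq xs).
have on_l : \forall k \near \oo, forall A, A \in l -> A k ->
    `|y k - step_fun c (phi k)| <= d.
  apply: filter_all_seq => A lA; have FA : F A by exact: lF.
  suff : \forall k \near within A \oo, `|y k - step_fun c (phi k)| <= d by [].
  have stepA : \forall k \near within A \oo,
      `|step_fun c (phi k) - v (lim (phi @ within A \oo))| <= d / 2.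
    have Axs : lim (phi @ within A \oo) \in xs.
      by rewrite mem_undup; apply/mapP; exists A.
    exact: phicvg A FA _ (cP _ Axs).
  have yA := cvgr_dist_le (V := R^o) y _ (ycvg A FA) _ d20.
  near=> k.
  have : `|step_fun c (phi k) - v (lim (phi @ within A \oo))| <= d / 2 by near: k; exact: stepA.
  have : `|lim (y @ within A \oo) - y k| <= d / 2 by near: k; exact: yA.
  rewrite vP// => h2 h1; rewrite (le_trans (ler_distD (lim (y @ within A \oo)) _ _))//.
  rewrite (distrC (y k)) (distrC _ (step_fun _ _)); lra.
have off_l : \forall k \near \oo, (~ exists2 A, A \in l & A k) -> `|y k| <= d.
  have := cvgr_dist_le (V := R^o) y 0 y0 _ d0.
  rewrite near_withinE; move=> off; near=> k => nA.
  rewrite -normrN -sub0r; suff kL : (~` \bigcup_(A in [set` l]) A) k.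
    by move: kL; near: k; exact: off.
  by move=> [A lA Ak]; apply: nA; exists A.
(* Only the coordinates below [m] remain, and rational approximations of [y] are listed there. *)
have [m _ mP] : \forall k \near \oo,
    `|y k| <= d \/ `|y k - step_fun c (phi k)| <= d.
  apply: filterS (filterI on_l off_l) => k [kon koff].
  have [[A lA Ak]|nA] := pselect (exists2 A, A \in l & A k).
    by right; exact: kon lA Ak.
  by left; exact: koff.
have /choice[r rP] : forall k, exists q : rat, `|ratr q - y k| <= d.
  by move=> k; exact: ratr_approx.
exists (mkseq r m, c) => k; rewrite /code_fun/= size_mkseq.
have [km|mk] := ltnP k m; last exact: mP.
by right; rewrite nth_mkseq// distrC.
Unshelve. all: by end_near. Qed.

(** Half of [d] pays for replacing [y] by an element of the span, the other half for coding that
    element. *)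
Lemma X_space_code (R : realType) (F : set (set nat)) (phi : nat -> R)
    (y : ell_infty R) (d : R) :
  almost_disjoint_family F ->
  (forall A, F A -> cvg (phi @ within A \oo)) ->
  (forall A B, F A -> F B -> A <> B ->
     lim (phi @ within A \oo) <> lim (phi @ within B \oo)) ->
  X_space F y -> 0 < d ->
  exists c, forall k, `|y k| <= d \/ `|y k - code_fun phi c k| <= d.
Proof.
move=> Fad phicvg phiinj yX d0.
have d20 : 0 < d / 2 by rewrite divr_gt0.
have [z [zspan yz]] := yX _ (nbhsx_ballx y (d / 2) d20).
have [c cP] := tame_code phicvg phiinj (tame_span Fad zspan) d20.
exists c => k.
have yzk : `|y k - z k| <= d / 2.
  by apply: le_trans (sup_norm_ub (y - z) k) _; exact: ltW.
have [zk|zk] := cP k; [left|right].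
  rewrite -[y k](subrK (z k)) (le_trans (ler_normD _ _))//; lra.
rewrite -[y k](subrK (z k)) -addrA (le_trans (ler_normD _ _))//; lra.
Qed.

Theorem proposition15 (R : realType) (F : set (set nat))
    (F_ad : almost_disjoint_family F) (F_emb : R_embeddable R F)
    (eps : R) (eps_gt0 : 0 < eps)
    (T : Type) (kappa : set T)
    (kappa_regular : regular_cardinal kappa)
    (kappa_uncountable : ~ countable kappa)
    (Y : set (ell_infty R))
    (Y_sphere : Y `<=` [set y | X_space F y /\ `|y| = 1])
    (Y_card : Y #= kappa) :
  exists Y' : set (ell_infty R),
    [/\ Y' `<=` Y, Y' #= kappa & concentrated (1 + eps) Y'].
Proof.
have [phi [phicvg phiinj]] := F_emb.
have d0 : 0 < eps / 2 by rewrite divr_gt0.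
have /choice[code codeP] : forall y : ell_infty R, exists c, X_space F y ->
    forall k, `|y k| <= eps / 2 \/ `|y k - code_fun phi c k| <= eps / 2.
  move=> y; have [yX|nyX] := pselect (X_space F y); last by exists ([::], [::]).
  by have [c cP] := X_space_code F_ad phicvg phiinj yX d0; exists c.
(* Codes are finite rational data, so [choice.pickle] numbers them injectively and a fibre consists
   of vectors with one code. *)
have [n Yn] := regular_pigeonhole (fun y => choice.pickle (code y))
  kappa_regular kappa_uncountable Y_card.
exists (Y `&` [set y | choice.pickle (code y) = n]).
split=> [y []|//|y z [/Y_sphere[yX y1] yn] [/Y_sphere[zX z1] zn] _] => //.
have yz : code y = code z by apply: (pcan_inj choice.pickleK); rewrite yn zn.
apply: sup_norm_le => k.
have yk : `|y k| <= 1 by rewrite -y1; exact: sup_norm_ub.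
have zk : `|z k| <= 1 by rewrite -z1; exact: sup_norm_ub.
have := codeP z zX k; have := codeP y yX k; rewrite yz.
(* The distance at [k] is at most [eps] if both values are near 0 or both near [s k], and at most
   [1 + eps / 2] in the mixed cases. *)
set s := code_fun _ _ _ => -[yd|yd] [zd|zd].
- by rewrite (le_trans (ler_normB _ _))//; lra.
- by rewrite (le_trans (ler_normB _ _))//; lra.
- by rewrite (le_trans (ler_normB _ _))//; lra.
- rewrite (le_trans (ler_distD s _ _))// (distrC s); lra.
Qed.
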